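(* For every $\lambda\in(0,1]$ there exists a constant $C=C(\lambda)\ge1$ such that the following holds. Let $d\ge1$ and let $(M_n)_{n\ge0}$ be an $\mathbb{R}^d$-valued martingale adapted to a filtration $(\mathcal{F}_n)_{n\ge0}$, with $M_0=0$, which satisfies, for every $n\ge0$, $$\mathbb{P}\big[\,|M_{n+1}-M_n|\le1\,\big]=1\qquad\text{and}\qquad \mathbb{E}\big[\,|M_{n+1}-M_n|^2\,\big|\,\mathcal{F}_n\big]=\lambda^2\ \text{ almost surely.}$$ Then, for every $n\ge1$, $$\mathbb{P}\big[\,|M_n|\le1\,\big]\le C\,n^{-1/2}.$$
   Context: $|\cdot|$ is the Euclidean norm on $\mathbb{R}^d$. *)

(* Defs.v *)
From HB Require Import structures.
From mathcomp Require Import all_boot all_order all_algebra.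
From mathcomp Require Import all_classical all_reals all_analysis.

Set Implicit Arguments.
Unset Strict Implicit.
Unset Printing Implicit Defensive.

Import Order.TTheory GRing.Theory Num.Theory.
Import numFieldNormedType.Exports.

Local Open Scope classical_set_scope.
Local Open Scope ring_scope.

(* The library norm `|v| on 'rV[R]_d is the sup norm, hence this definition. *)
Definition enorm (R : realType) (d : nat) (v : 'rV[R]_d) : R :=
  Num.sqrt (\sum_(i < d) v ord0 i ^+ 2).

Definition filtration (disp : measure_display) (T : measurableType disp)
    (F : nat -> set (set T)) : Prop :=
  [/\ forall n, sigma_algebra setT (F n),
      forall n, F n `<=` measurable &
      forall m n, (m <= n)%N -> F m `<=` F n].

(* Measurability of X with respect to a sub-sigma-algebra G of T, which need
   not be the canonical sigma-algebra of T. *)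
Definition measurable_wrt (disp : measure_display) (T : measurableType disp)
    (R : realType) (G : set (set T)) (X : T -> R) : Prop :=
  forall B : set R, measurable B -> G (X @^-1` B).

(* E[X | G] = Y almost surely (Kolmogorov): the integrable G-measurable
   variable Y is a version of the conditional expectation of the integrable
   variable X given G.  Versions are unique up to almost sure equality. *)
Definition is_condexp (disp : measure_display) (T : measurableType disp)
    (R : realType) (P : probability T R) (G : set (set T)) (X Y : T -> R) :
    Prop :=
  [/\ P.-integrable setT (EFin \o X),
      measurable_wrt G Y,
      P.-integrable setT (EFin \o Y) &
      forall A, G A ->
        (\int[P]_(w in A) (Y w)%:E = \int[P]_(w in A) (X w)%:E)%E].

(* Measurability, integrability and conditional expectation of R^d-valued
   variables are taken coordinatewise. *)
Definition martingale (disp : measure_display) (T : measurableType disp)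
    (R : realType) (P : probability T R) (F : nat -> set (set T)) (d : nat)
    (M : nat -> T -> 'rV[R]_d) : Prop :=
  [/\ forall n (i : 'I_d), measurable_wrt (F n) (fun w => M n w ord0 i),
      forall n (i : 'I_d), P.-integrable setT (fun w => (M n w ord0 i)%:E) &
      forall n (i : 'I_d),
        is_condexp P (F n) (fun w => M n.+1 w ord0 i) (fun w => M n w ord0 i)].

(* Main.v *)
Require Import Defs.
From HB Require Import structures.
From mathcomp Require Import all_boot all_order all_algebra.
From mathcomp Require Import all_classical all_reals all_analysis.
From mathcomp Require Import measurable_realfun ring lra.

(** Write Phi_n(s) = E exp(-|M_n|^2 / 2s) and c = lambda^2. Among all covariances
    of trace c, the radial one is the worst for a Gaussian, so s^(-1/2)
    exp(-|x|^2 / 2s) is a supersolution of the controlled heat equation in every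
    dimension. A second order Taylor expansion of the Gaussian turns this into
      Phi_(n+1)(s) <= sqrt (s / (s + c)) Phi_n(s + c) + K s^(-3/2) Phi_n(2s),
    where the remainder is again controlled by a Gaussian, of twice the variance.
    Hence Phi_n(s) <= (1 + D / sqrt s) sqrt (s / (s + c n)) by induction on n,
    simultaneously for all large s: the decrease of D / sqrt s pays for the
    remainder. A ball of radius 1 has probability at most e Phi_n(s). *)

Set Implicit Arguments.
Unset Strict Implicit.
Unset Printing Implicit Defensive.

Import Order.TTheory GRing.Theory Num.Theory.
Import numFieldNormedType.Exports.

Local Open Scope classical_set_scope.
Local Open Scope ring_scope.


(** * Scalar inequalities for the exponential and the Gaussian *)

Lemma series_exp_coeff_le_expR (R : realType) (x : R) (n : nat) : 0 <= x ->
  series (exp_coeff x) n <= expR x.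
Proof.
move=> x0; rewrite /expR; apply: (nondecreasing_cvgn_le _ (is_cvg_series_exp_coeff x)).
apply/nondecreasing_seqP => m; rewrite /series /= big_nat_recr //= lerDl.
exact: exp_coeff_ge0.
Qed.

(** Since [1/(i+3)! <= 1/i!], the series from the third order on is at most [|x|^3] times the
    exponential series at [|x|]. This treats both signs of [x] at once. *)
Lemma expR_le_quadratic_cubic (R : realType) (x : R) :
  expR x <= 1 + x + x ^+ 2 / 2 + `|x| ^+ 3 * expR `|x|.
Proof.
rewrite {1}/expR; apply: limr_le; first exact: is_cvg_series_exp_coeff.
exists 3%N => // m /= m3; rewrite -(subnKC m3); set n := (m - 3)%N.
have -> : series (exp_coeff x) (3 + n)%N =
    1 + x + x ^+ 2 / 2 + \sum_(0 <= i < n) exp_coeff x (i + 3)%N.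
  rewrite /series /= (@big_cat_nat _ _ _ 3) //=.
  congr (_ + _).
    rewrite !big_nat_recr //= big_geq // /exp_coeff /=.
    by rewrite !factS fact0 expr0 expr1 !muln1 !divr1 add0r.
  by rewrite -{1}[3%N]add0n big_addn addnC addnK.
rewrite lerD2l (le_trans _ (ler_wpM2l _ (series_exp_coeff_le_expR n _))) //.
rewrite /series /= mulr_sumr; apply: ler_sum => i _; rewrite /exp_coeff /=.
rewrite (le_trans (ler_norm _)) // normrM normrX normfV normr_nat.
rewrite exprD mulrC [leRHS]mulrA [leRHS]mulrC -(mulrC (_ ^+ 3)).
rewrite ler_wpM2r // ?mulr_ge0 ?exprn_ge0 //.
rewrite lef_pV2 ?posrE ?ltr0n ?fact_gt0 // ler_nat.
by apply: leq_fact; rewrite leq_addr.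
Qed.

(* Here [S = sqrt s] and [y = |u| / S]; the remainder is a cubic polynomial in [y]
   times [exp (y + 1/2)], and [2 y + 1 <= 5 + y^2 / 4]. *)
Lemma gauss_taylor_upper (R : realType) (S y a b : R) :
  1 <= S -> 0 <= y -> 0 <= b <= 1 -> a ^+ 2 <= (S * y) ^+ 2 * b ->
  expR (- ((2 * a + b) / (2 * S ^+ 2))) <=
    1 - a / S ^+ 2 + (y ^+ 2 - 1) * b / (2 * S ^+ 2)
    + 7 * expR 5 * S ^- 3 * expR (y ^+ 2 / 4).
Proof.
move=> S1 y0 /andP[b0 b1] hab.
have S0 : 0 < S by lra.
have Sn0 : S != 0 by rewrite gt_eqF.
have ha : `|a| <= S * y.
  have Sy0 : 0 <= S * y by rewrite mulr_ge0 // ltW.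
  rewrite -(@ler_pXn2r _ 2%N) // real_normK ?num_real //.
  apply: (le_trans hab); rewrite ler_piMr //; exact: sqr_ge0.
set t := - _.
(* Here [|a| <= S y] and [b <= 1 <= S], so [|2 a + b| <= 2 S y + S]. *)
have ht : `|t| <= (y + 2^-1) / S.
  rewrite /t normrN normrM normfV (ger0_norm (_ : 0 <= 2 * S ^+ 2)); last first.
    by rewrite mulr_ge0 // sqr_ge0.
  rewrite ler_pdivrMr; last by rewrite mulr_gt0 // exprn_gt0.
  have -> : (y + 2^-1) / S * (2 * S ^+ 2) = 2 * (S * y) + S by field.
  rewrite (le_trans (ler_normD _ _)) // normrM (ger0_norm b0) normr_nat; lra.
have ht1 : `|t| <= y + 2^-1.
  by rewrite (le_trans ht) // ler_pdivrMr //; nra.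
have hy : expR (2 * y + 1) <= expR 5 * expR (y ^+ 2 / 4).
  by rewrite -expRD ler_expR; have := sqr_ge0 (y / 2 - 2); lra.
(* The 6 is [3!], from [z^3 <= 3! exp z] at [z = y + 1/2]; the two factors [exp z] combine to
   [exp (2 y + 1)]. *)
have hcub : `|t| ^+ 3 * expR `|t| <= 6 * S ^- 3 * expR (2 * y + 1).
  have h1 : `|t| ^+ 3 <= (y + 2^-1) ^+ 3 * S ^- 3.
    rewrite -exprVn -exprMn lerXn2r ?nnegrE //.
    by rewrite divr_ge0 //; lra.
  have h2 : expR `|t| <= expR (y + 2^-1) by rewrite ler_expR.
  have h3 : (y + 2^-1) ^+ 3 <= 6 * expR (y + 2^-1).
    have := @expR_ge1Dxn R (y + 2^-1) 2 ltac:(lra).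
    have -> : (3`! = 6)%N by [].
    lra.
  have -> : 2 * y + 1 = (y + 2^-1) + (y + 2^-1) by lra.
  rewrite expRD mulrA.
  apply: ler_pM; rewrite ?exprn_ge0 ?expR_ge0 //.
  rewrite (le_trans h1) // [leRHS]mulrAC ler_wpM2r // invr_ge0 exprn_ge0 //.
  lra.
(* The square [a^2] gives the main term through the hypothesis; [a b <= S y] and [b^2 <= S] go into
   the remainder. With [hlin] they raise the 6 of [hcub] to 7. *)
have hq : t ^+ 2 / 2 <= y ^+ 2 * b / (2 * S ^+ 2) + S ^- 3 * (y / 2 + 8^-1).
  have -> : t ^+ 2 / 2 = (a ^+ 2 + a * b + b ^+ 2 / 4) / (2 * S ^+ 4).
    by rewrite /t; field.
  rewrite ler_pdivrMr; last by rewrite mulr_gt0 // exprn_gt0.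
  have -> : (y ^+ 2 * b / (2 * S ^+ 2) + S ^- 3 * (y / 2 + 8^-1)) * (2 * S ^+ 4)
     = (S * y) ^+ 2 * b + S * y + S / 4 by field.
  have : a * b <= S * y.
    by rewrite (le_trans (ler_norm _)) // normrM (ger0_norm b0); have := normr_ge0 a; nra.
  nra.
have hlin : y / 2 + 8^-1 <= expR (2 * y + 1).
  by have := expR_ge1Dx (2 * y + 1); lra.
apply: le_trans (expR_le_quadratic_cubic _) _.
have S3 : 0 <= S ^- 3 by rewrite invr_ge0 exprn_ge0 // ltW.
have -> : 7 * expR 5 * S ^- 3 * expR (y ^+ 2 / 4) = 7 * S ^- 3 * (expR 5 * expR (y ^+ 2 / 4)) by ring.
have e1 : S ^- 3 * (y / 2 + 8^-1) <= S ^- 3 * (expR 5 * expR (y ^+ 2 / 4)).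
  by rewrite ler_wpM2l // (le_trans hlin).
have e2 : S ^- 3 * expR (2 * y + 1) <= S ^- 3 * (expR 5 * expR (y ^+ 2 / 4)).
  by rewrite ler_wpM2l.
have -> : 1 - a / S ^+ 2 + (y ^+ 2 - 1) * b / (2 * S ^+ 2) =
   1 + t + y ^+ 2 * b / (2 * S ^+ 2) by rewrite /t; field.
lra.
Qed.

(** The left side is the first order expansion in [c]. After squaring, the deficit
    [c^2 (3 s - c) / (4 s^2)] is nonnegative because [c <= s]. *)
Lemma sqrt_ratio_ge (R : realType) (s c : R) : 0 <= c -> c <= s -> 0 < s ->
  1 - c / (2 * s) <= Num.sqrt (s / (s + c)).
Proof.
move=> c0 cs s0.
have h : 0 <= 1 - c / (2 * s).
  by rewrite subr_ge0 ler_pdivrMr ?mulr_gt0 //; lra.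
rewrite -(ger0_norm h) -sqrtr_sqr ler_wsqrtr // ler_pdivlMr; last by lra.
have -> : (1 - c / (2 * s)) ^+ 2 * (s + c) =
  s - c ^+ 2 / (4 * s ^+ 2) * (3 * s - c) by field; rewrite gt_eqF.
rewrite lerBlDl lerDr mulr_ge0 ?divr_ge0 ?mulr_ge0 ?sqr_ge0 //; lra.
Qed.

(** The left side is the expansion to first order in [c] of the product on the right, where
    [S^2 = s] and [y^2 = q / s]. The bounds [exp v >= 1 + v] and [sqrt_ratio_ge] lose at most
    [S^-3 y^2], which the last term absorbs. *)
Lemma gauss_time_shift_lower (R : realType) (S y c : R) :
  1 <= S -> 0 <= c <= 1 ->
  1 + c * (y ^+ 2 - 1) / (2 * S ^+ 2) <=
    Num.sqrt (S ^+ 2 / (S ^+ 2 + c)) * expR (y ^+ 2 * c / (2 * (S ^+ 2 + c)))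
    + 4 * S ^- 3 * expR (y ^+ 2 / 4).
Proof.
move=> S1 /andP[c0 c1].
have S0 : 0 < S by lra.
have Sn0 : S != 0 by rewrite gt_eqF.
have s1 : 1 <= S ^+ 2 by nra.
have Scn0 : S ^+ 2 + c != 0 by rewrite gt_eqF //; lra.
set v := y ^+ 2 * c / _.
have v0 : 0 <= v.
  rewrite /v; apply: divr_ge0; apply: mulr_ge0 => //; rewrite ?sqr_ge0 //.
  lra.
have h1 : 1 + v <= expR v := expR_ge1Dx v.
have h2 : 1 - c / (2 * S ^+ 2) <= Num.sqrt (S ^+ 2 / (S ^+ 2 + c)).
  by apply: sqrt_ratio_ge; lra.
have h3 : (1 - c / (2 * S ^+ 2)) * (1 + v) <= Num.sqrt (S ^+ 2 / (S ^+ 2 + c)) * expR v.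
  apply: ler_pM => //; last by lra.
  by rewrite subr_ge0 ler_pdivrMr; nra.
have h4 : y ^+ 2 / 4 <= expR (y ^+ 2 / 4).
  by have := expR_ge1Dx (y ^+ 2 / 4); lra.
have h5 : S ^- 3 * y ^+ 2 <= 4 * S ^- 3 * expR (y ^+ 2 / 4).
  rewrite (mulrC 4) -mulrA; apply: ler_wpM2l; last by lra.
  by rewrite invr_ge0 exprn_ge0 // ltW.
suff : 1 + c * (y ^+ 2 - 1) / (2 * S ^+ 2) <=
   (1 - c / (2 * S ^+ 2)) * (1 + v) + S ^- 3 * y ^+ 2 by lra.
(* The two subtracted fractions are at most 1/2 and 1/4 by [h7], hence below [S >= 1] in total. *)
have -> : (1 - c / (2 * S ^+ 2)) * (1 + v) + S ^- 3 * y ^+ 2 =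
    1 + c * (y ^+ 2 - 1) / (2 * S ^+ 2) +
    y ^+ 2 / S ^+ 4 * (S - c ^+ 2 * S ^+ 2 / (2 * (S ^+ 2 + c))
                         - c ^+ 2 * S ^+ 2 / (4 * (S ^+ 2 + c))).
  by rewrite /v; field; rewrite Scn0.
rewrite lerDl mulr_ge0 ?divr_ge0 ?sqr_ge0 ?exprn_ge0 ?ltW //.
have h7 : c ^+ 2 * S ^+ 2 / (S ^+ 2 + c) <= 1.
  rewrite ler_pdivrMr ?mul1r; last by lra.
  have : c ^+ 2 * S ^+ 2 <= S ^+ 2 by rewrite ler_piMl ?sqr_ge0 ?expr_le1.
  lra.
have -> : c ^+ 2 * S ^+ 2 / (2 * (S ^+ 2 + c)) = c ^+ 2 * S ^+ 2 / (S ^+ 2 + c) / 2.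
  by field; rewrite Scn0.
have -> : c ^+ 2 * S ^+ 2 / (4 * (S ^+ 2 + c)) = c ^+ 2 * S ^+ 2 / (S ^+ 2 + c) / 4.
  by field; rewrite Scn0.
lra.
Qed.


(** * Integration and conditional expectation against bounded weights *)

Lemma staircase_le (R : realType) (z : R) (K : nat) : 0 <= z ->
  \sum_(j < K) (j.+1%:R <= z)%R%:R <= z.
Proof.
move=> z0; elim: K => [|K IH]; first by rewrite big_ord0.
have [zK|zK] := leP K.+1%:R z.
  apply: le_trans zK; rewrite -[K.+1 in leRHS]card_ord -sumr_const.
  by apply: ler_sum => j _; rewrite lern1 leq_b1.
by rewrite big_ord_recr /= (lt_geF zK) addr0.
Qed.

(** The sum counts the integers of [1, K] that are at most [z]. When [z <= K] none is missed, so the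
    count is the floor of [z], or 0 for negative [z]. *)
Lemma staircase_ge (R : realType) (z : R) (K : nat) : z <= K%:R ->
  z - 1 <= \sum_(j < K) (j.+1%:R <= z)%R%:R.
Proof.
elim: K => [|K IH] zK; first by rewrite big_ord0; lra.
rewrite big_ord_recr /=; have [zK'|zK'] := leP z K%:R.
  by rewrite (le_trans (IH zK')) // lerDl.
have -> : \sum_(j < K) (j.+1%:R <= z)%R%:R = K%:R :> R.
  rewrite -[K in RHS]card_ord -sumr_const; apply: eq_bigr => j _.
  by rewrite (le_trans _ (ltW zK')) // ler_nat.
have : 0 <= (K.+1%:R <= z)%R%:R :> R by [].
by move: zK; rewrite -natr1; lra.
Qed.

Lemma bounded_setT (T : Type) (R : realType) (f : T -> R) (c : R) :
  (forall x, `|f x| <= c) -> [bounded f x | x in [set: T]].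
Proof.
move=> fc; exists c; split; first exact: num_real.
by move=> m cm x _; exact: le_trans (fc x) (ltW cm).
Qed.

Section Integrals.
Context {disp : measure_display} {T : measurableType disp} {R : realType}.
Context (P : probability T R).
Implicit Types (f g X Y Z : T -> R).

Lemma ae_le_Rintegral f g :
  P.-integrable setT (EFin \o f) -> P.-integrable setT (EFin \o g) ->
  {ae P, forall x, f x <= g x} -> \int[P]_x f x <= \int[P]_x g x.
Proof.
move=> intf intg [N [mN N0 fgN]].
rewrite /Rintegral (negligible_integral mN measurableT intf N0).
rewrite [in leRHS](negligible_integral mN measurableT intg N0).
apply: le_Rintegral.
- exact: measurableD.
- by apply: integrableS intf => //; exact: measurableD.
- by apply: integrableS intg => //; exact: measurableD.
- by move=> x [_ Nx]; apply: contrapT => h; apply: Nx; exact: fgN.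
Qed.

Lemma integrable_bounded f (c : R) : measurable_fun setT f ->
  (forall x, `|f x| <= c) -> P.-integrable setT (EFin \o f).
Proof.
move=> mf fc; apply: measurable_bounded_integrable => //.
  by rewrite (le_lt_trans (probability_le1 _ _)) ?ltry.
exact: bounded_setT fc.
Qed.

Lemma integrable_bounded_mul f g (c : R) : measurable_fun setT f ->
  (forall x, `|f x| <= c) -> P.-integrable setT (EFin \o g) ->
  P.-integrable setT (EFin \o (fun x => f x * g x)).
Proof. by move=> mf fc; apply: integrableMr => //; exact: bounded_setT fc. Qed.

Lemma integrable_sumR (I : Type) (s : seq I) (f : I -> T -> R) :
  (forall i, P.-integrable setT (EFin \o f i)) ->
  P.-integrable setT (EFin \o (fun x => \sum_(i <- s) f i x)).
Proof.
move=> intf; have := @integrable_sum _ _ _ P setT measurableT _ s xpredT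
  (fun i => EFin \o f i) (fun i _ => intf i).
by apply: eq_integrable => // x _ /=; rewrite sumEFin.
Qed.

Lemma Rintegral_sum (I : Type) (s : seq I) (f : I -> T -> R) :
  (forall i, P.-integrable setT (EFin \o f i)) ->
  \int[P]_x (\sum_(i <- s) f i x) = \sum_(i <- s) \int[P]_x f i x.
Proof.
move=> intf; elim: s => [|i s IH].
  under eq_Rintegral do rewrite big_nil.
  by rewrite big_nil Rintegral_cst // mul0r.
under eq_Rintegral do rewrite big_cons.
by rewrite big_cons RintegralD // ?IH //; exact: integrable_sumR.
Qed.

(** Viewing [G] as the canonical sigma-algebra of a copy of [T] makes the closure properties of
    measurable functions available for [G]. *)
Lemma measurable_wrt_g_sigma_algebraP (G : set (set T)) (X : T -> R) :
  sigma_algebra setT G ->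
  measurable_wrt G X <-> measurable_fun setT (X : g_sigma_algebraType G -> R).
Proof.
move=> sG; split => [mX _ B mB|mX B mB].
  by rewrite setTI; apply: sub_sigma_algebra; exact: mX.
by have := mX measurableT B mB; rewrite setTI /measurable /= sigma_algebra_id.
Qed.

Lemma measurable_wrt_measurable_fun (G : set (set T)) (X : T -> R) :
  G `<=` measurable -> measurable_wrt G X -> measurable_fun setT X.
Proof. by move=> GT mX _ B mB; rewrite setTI; exact/GT/mX. Qed.

(* The layers [{Z >= (j + 1) / (N + 1)}] of a nonnegative bounded [Z] belong to [G],
   and the sum of their indicators is within [1] of [(N + 1) * Z]. *)
Lemma Rintegral_bounded_mul_eq0 (G : set (set T)) (D Z : T -> R) (c : R) :
  G `<=` measurable -> measurable_wrt G Z -> (forall x, 0 <= Z x <= c) ->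
  P.-integrable setT (EFin \o D) ->
  (forall A, G A -> \int[P]_(x in A) D x = 0) ->
  \int[P]_x (Z x * D x) = 0.
Proof.
move=> GT mZ Zc intD D0.
have mZT := measurable_wrt_measurable_fun GT mZ.
have Z0 x : 0 <= Z x by case/andP: (Zc x).
have nZ x : `|Z x| <= c by rewrite ger0_norm //; case/andP: (Zc x).
have intZD := integrable_bounded_mul mZT nZ intD.
(* A bound on all multiples by one fixed number forces the integral to vanish. *)
suff h N : N.+1%:R * `|\int[P]_x (Z x * D x)| <= \int[P]_x `|D x|.
  apply/eqP; rewrite -normr_eq0; apply/negPn/negP => n0.
  have p0 : 0 < `|\int[P]_x (Z x * D x)| by rewrite lt0r n0 /=.
  have [N hN] : exists N, \int[P]_x `|D x| / `|\int[P]_x (Z x * D x)| < N.+1%:R.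
    exists (Num.truncn (\int[P]_x `|D x| / `|\int[P]_x (Z x * D x)|)).
    by rewrite truncnS_gt.
  by have := h N; rewrite leNgt -ltr_pdivrMr // hN.
(* With this many layers the staircase reaches the top of the range of [(N + 1) Z]. *)
have [K hK] : exists K : nat, N.+1%:R * c <= K%:R.
  by exists (Num.truncn (N.+1%:R * c)).+1; rewrite ltW // truncnS_gt.
pose A j := [set x | j.+1%:R <= N.+1%:R * Z x].
have GA j : G (A j).
  have -> : A j = Z @^-1` `[j.+1%:R / N.+1%:R, +oo[%classic.
    by apply/seteqP; split => x /=; rewrite in_itv /= andbT ler_pdivrMr // mulrC.
  by apply: mZ; exact: measurable_itv.
pose S x := \sum_(j < K) (\1_(A j) x : R).
have SE x : S x = \sum_(j < K) (j.+1%:R <= N.+1%:R * Z x)%R%:R.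
  by apply: eq_bigr => j _; rewrite indicE mem_setE.
have intAD j : P.-integrable setT (EFin \o (fun x => \1_(A j) x * D x)).
  apply: (@integrable_bounded_mul _ _ 1) => //.
    by apply: measurable_indic; exact: GT.
  by move=> x; rewrite indicE normr_nat lern1; case: (_ \in _).
have SD x : S x * D x = \sum_(j < K) \1_(A j) x * D x by rewrite /S mulr_suml.
have intSD : P.-integrable setT (EFin \o (fun x => S x * D x)).
  under [X in EFin \o X]eq_fun do rewrite SD.
  exact: integrable_sumR.
have SD0 : \int[P]_x (S x * D x) = 0.
  under eq_Rintegral do rewrite SD.
  rewrite Rintegral_sum // big1 // => j _.
  rewrite -(D0 _ (GA j)) [RHS]Rintegral_mkcond; apply: eq_Rintegral => x _.
  by rewrite patchE indicE; case: (_ \in _); rewrite ?mul1r ?mul0r.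
have intNZD : P.-integrable setT (EFin \o (fun x => N.+1%:R * (Z x * D x))).
  exact: (@integrableZl _ _ _ P setT measurableT N.+1%:R _ intZD).
have -> : N.+1%:R * `|\int[P]_x (Z x * D x)| =
    `|\int[P]_x (N.+1%:R * (Z x * D x) - S x * D x)|.
  by rewrite RintegralB // SD0 subr0 RintegralZl // normrM normr_nat.
apply: le_trans (le_normr_Rintegral _ _) _ => //.
  exact: (integrableB measurableT intNZD intSD).
apply: le_Rintegral => //.
- exact/integrable_norm/(integrableB measurableT intNZD intSD).
- exact: integrable_norm.
move=> x _; rewrite mulrA -mulrBl normrM ler_piMl // SE.
have z0 : 0 <= N.+1%:R * Z x by rewrite mulr_ge0.
rewrite ger0_norm ?subr_ge0 ?staircase_le // lerBlDr -lerBlDl staircase_ge //.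
by apply: le_trans hK; rewrite ler_pM2l //; case/andP: (Zc x).
Qed.

(** The difference [X - Y] integrates to 0 over every set of [G]. The previous lemma wants a
    nonnegative weight, so it is applied to [Z + c]; the shift contributes [c] times the integral of
    [X - Y] over the whole space, which is 0. *)
Lemma condexp_bounded_mul (G : set (set T)) (X Y Z : T -> R) (c : R) :
  sigma_algebra setT G -> G `<=` measurable -> is_condexp P G X Y ->
  measurable_wrt G Z -> (forall x, `|Z x| <= c) ->
  \int[P]_x (Z x * X x) = \int[P]_x (Z x * Y x).
Proof.
move=> sG GT [intX mY intY XY] mZ Zc.
have mZT := measurable_wrt_measurable_fun GT mZ.
have intZX := integrable_bounded_mul mZT Zc intX.
have intZY := integrable_bounded_mul mZT Zc intY.
have intD : P.-integrable setT (EFin \o (fun x => X x - Y x)).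
  exact: (integrableB measurableT intX intY).
have D0 A : G A -> \int[P]_(x in A) (X x - Y x) = 0.
  move=> GA; rewrite RintegralB; last 3 first.
  - exact: GT.
  - by apply: integrableS intX => //; exact: GT.
  - by apply: integrableS intY => //; exact: GT.
  by rewrite /Rintegral XY // subrr.
have GTT : G setT.
  by case: sG => G0 GC _; have := GC _ G0; rewrite setD0.
have mZc : measurable_wrt G (fun x => Z x + c).
  apply/measurable_wrt_g_sigma_algebraP => //.
  by apply: measurable_funD => //; exact/measurable_wrt_g_sigma_algebraP.
have Zc2 x : 0 <= Z x + c <= c + c.
  by have := Zc x; rewrite ler_norml => /andP[? ?]; apply/andP; split; lra.
have intcD : P.-integrable setT (EFin \o (fun x => c * (X x - Y x))).
  exact: (@integrableZl _ _ _ P setT measurableT c _ intD).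
have := Rintegral_bounded_mul_eq0 GT mZc Zc2 intD D0.
have -> : \int[P]_x ((Z x + c) * (X x - Y x)) =
    \int[P]_x ((Z x * X x - Z x * Y x) + c * (X x - Y x)).
  by apply: eq_Rintegral => x _; ring.
rewrite RintegralD //; last exact: (integrableB measurableT intZX intZY).
rewrite RintegralZl // D0 // mulr0 addr0 RintegralB //.
by move/eqP; rewrite subr_eq0 => /eqP.
Qed.

End Integrals.


(** * Squared Euclidean norm and inner product *)

Section Euclidean.
Context {R : realType} {d : nat}.
Implicit Types u v : 'rV[R]_d.

Definition dotp u v : R := \sum_(i < d) u ord0 i * v ord0 i.

Definition sqnorm u : R := \sum_(i < d) u ord0 i ^+ 2.

Lemma sqnorm_ge0 u : 0 <= sqnorm u.
Proof. by apply: sumr_ge0 => i _; exact: sqr_ge0. Qed.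

Lemma enorm_sqr u : enorm u ^+ 2 = sqnorm u.
Proof. by rewrite sqr_sqrtr // sqnorm_ge0. Qed.

Lemma enorm_le1 u : (enorm u <= 1) = (sqnorm u <= 1).
Proof. by rewrite -enorm_sqr expr_le1 // sqrtr_ge0. Qed.

Lemma sqr_coord_le_sqnorm u i : u ord0 i ^+ 2 <= sqnorm u.
Proof. by rewrite /sqnorm (bigD1 i) //= lerDl sumr_ge0 // => j _; exact: sqr_ge0. Qed.

Lemma sqnormD u v : sqnorm (u + v) = sqnorm u + 2 * dotp u v + sqnorm v.
Proof.
rewrite /sqnorm /dotp mulr_sumr -!big_split /=; apply: eq_bigr => i _.
by rewrite mxE; ring.
Qed.

(** Cauchy-Schwarz: the squared norm of [a u - b v] is nonnegative, taken at [a = sqnorm v] and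
    [b = dotp u v], then divided by [sqnorm v]. If [sqnorm v = 0], all coordinates of [v] vanish. *)
Lemma dotp_sqr_le u v : dotp u v ^+ 2 <= sqnorm u * sqnorm v.
Proof.
have hsq a b : 0 <= a ^+ 2 * sqnorm u - 2 * a * b * dotp u v + b ^+ 2 * sqnorm v.
  suff -> : a ^+ 2 * sqnorm u - 2 * a * b * dotp u v + b ^+ 2 * sqnorm v =
      \sum_(i < d) (a * u ord0 i - b * v ord0 i) ^+ 2.
    by apply: sumr_ge0 => i _; exact: sqr_ge0.
  rewrite /sqnorm /dotp !mulr_sumr -sumrB -big_split /=.
  by apply: eq_bigr => i _; ring.
have [v0|v0] := eqVneq (sqnorm v) 0.
  suff -> : dotp u v = 0 by rewrite v0 mulr0 expr0n.
  apply: big1 => i _; have := sqr_coord_le_sqnorm v i.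
  by rewrite v0 real_exprn_even_le0 ?num_real //= => /eqP ->; rewrite mulr0.
have vp : 0 < sqnorm v by rewrite lt0r v0 sqnorm_ge0.
rewrite -subr_ge0 -(pmulr_rge0 _ vp).
have -> : sqnorm v * (sqnorm u * sqnorm v - dotp u v ^+ 2) =
  sqnorm v ^+ 2 * sqnorm u - 2 * sqnorm v * dotp u v * dotp u v
  + dotp u v ^+ 2 * sqnorm v by ring.
exact: hsq.
Qed.

End Euclidean.

(** * Gaussian weights *)

(** The argument [q] stands for [|x|^2]. The value at the origin is 1 for every [s], so no factor
    depending on the dimension appears. *)
Definition gauss (R : realType) (s q : R) : R := expR (- (q / (2 * s))).

Section Gauss.
Context {R : realType}.
Implicit Types s q c : R.

Lemma gauss_ge0 s q : 0 <= gauss s q.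
Proof. exact: expR_ge0. Qed.

Lemma gauss_le1 s q : 0 < s -> 0 <= q -> gauss s q <= 1.
Proof. by move=> s0 q0; rewrite expR_le1 oppr_le0 divr_ge0 // mulr_ge0 // ltW. Qed.

(** From [exp x >= x] at [x = q / (2 s)]; it bounds the weights that multiply the increments in the
    one-step estimate. *)
Lemma mul_gauss_le s q : 0 < s -> q * gauss s q <= 2 * s.
Proof.
move=> s0; rewrite /gauss expRN ler_pdivrMr ?expR_gt0 //.
have h := expR_ge1Dx (q / (2 * s)).
have {1}-> : q = 2 * s * (q / (2 * s)) by field; rewrite gt_eqF.
rewrite ler_pM2l ?mulr_gt0 //; lra.
Qed.

(** [gauss_taylor_upper] at [y = |u| / sqrt s], multiplied by [gauss s (sqnorm u)]. Cauchy-Schwarz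
    replaces [dotp u v ^ 2] by its radial value, and the factor [exp (y^2 / 4)] turns the variance
    [s] into [2 s]. *)
Lemma gauss_taylor_le (d : nat) (s : R) (u v : 'rV[R]_d) : 1 <= s -> sqnorm v <= 1 ->
  gauss s (sqnorm (u + v)) <=
    gauss s (sqnorm u) *
      (1 - dotp u v / s + (sqnorm u / s - 1) * sqnorm v / (2 * s))
    + 7 * expR 5 * Num.sqrt s ^- 3 * gauss (2 * s) (sqnorm u).
Proof.
move=> s1 v1; set q := sqnorm u; set S := Num.sqrt s.
have q0 : 0 <= q := sqnorm_ge0 u.
have s0 : 0 < s by lra.
have sE : S ^+ 2 = s by rewrite sqr_sqrtr // ltW.
have S1 : 1 <= S by rewrite -[1]sqrtr1 ler_wsqrtr.
have Sn0 : S != 0 by rewrite gt_eqF //; lra.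
pose y := Num.sqrt q / S.
have yE : y ^+ 2 = q / s by rewrite expr_div_n sqr_sqrtr // sE.
have SyE : (S * y) ^+ 2 = q by rewrite exprMn yE sE; field; rewrite gt_eqF.
have := @gauss_taylor_upper R S y (dotp u v) (sqnorm v) S1.
rewrite divr_ge0 ?sqrtr_ge0 ?sqnorm_ge0 //= SyE dotp_sqr_le sE yE v1.
move=> /(_ isT isT isT) h.
have -> : gauss s (sqnorm (u + v)) =
    gauss s q * expR (- ((2 * dotp u v + sqnorm v) / (2 * s))).
  rewrite /gauss -expRD sqnormD -/q; congr expR; field.
  by rewrite gt_eqF.
have -> : gauss (2 * s) q = gauss s q * expR (q / s / 4).
  by rewrite /gauss -expRD; congr expR; field; rewrite gt_eqF.
by rewrite mulrCA -mulrDr ler_wpM2l ?gauss_ge0.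
Qed.

(** The left side is what the Taylor bound leaves after averaging over the increment, with mean 0
    for [dotp u v] and mean [c] for [sqnorm v]. *)
Lemma gauss_time_shift_le s c q : 1 <= s -> 0 <= c <= 1 -> 0 <= q ->
  gauss s q * (1 + c * (q / s - 1) / (2 * s)) <=
    Num.sqrt (s / (s + c)) * gauss (s + c) q
    + 4 * Num.sqrt s ^- 3 * gauss (2 * s) q.
Proof.
move=> s1 c01 q0; set S := Num.sqrt s.
have s0 : 0 < s by lra.
have sE : S ^+ 2 = s by rewrite sqr_sqrtr // ltW.
have S1 : 1 <= S by rewrite -[1]sqrtr1 ler_wsqrtr.
have sc0 : 0 < s + c by case/andP: c01; lra.
have [sn0 scn0] : s != 0 /\ s + c != 0 by rewrite !gt_eqF.
have := @gauss_time_shift_lower R S (Num.sqrt q / S) c S1 c01.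
rewrite expr_div_n sqr_sqrtr // sE => h.
have -> : gauss (s + c) q = gauss s q * expR (q / s * c / (2 * (s + c))).
  by rewrite /gauss -expRD; congr expR; field; rewrite sn0 scn0.
have -> : gauss (2 * s) q = gauss s q * expR (q / s / 4).
  by rewrite /gauss -expRD; congr expR; field; rewrite gt_eqF.
by rewrite !(mulrCA _ (gauss s q)) -mulrDr ler_wpM2l ?gauss_ge0.
Qed.

Lemma measurable_sqnorm (disp : measure_display) (T : measurableType disp)
    (d : nat) (X : T -> 'rV[R]_d) :
  (forall i, measurable_fun setT (fun w => X w ord0 i)) ->
  measurable_fun setT (fun w => sqnorm (X w)).
Proof.
by move=> mX; apply: measurable_sum => i; exact: measurable_funX.
Qed.

Lemma measurable_gauss (disp : measure_display) (T : measurableType disp)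
    (s : R) (q : T -> R) :
  measurable_fun setT q -> measurable_fun setT (fun w => gauss s (q w)).
Proof.
move=> mq; apply: (measurableT_comp (@measurable_expR R)).
apply: measurable_funN.
apply: measurable_funM => //.
Qed.

End Gauss.


(** * Evolution of the Gaussian expectation over one step *)

Section OneStep.
Context {disp : measure_display} {T : measurableType disp} {R : realType}.
Context (P : probability T R).
Context {d : nat}.

Lemma integrable_gauss (s : R) (X : T -> 'rV[R]_d) : 0 < s ->
  (forall i, measurable_fun setT (fun w => X w ord0 i)) ->
  P.-integrable setT (EFin \o (fun w => gauss s (sqnorm (X w)))).
Proof.
move=> s0 mX; apply: (@integrable_bounded _ _ _ _ _ 1).
  exact/measurable_gauss/measurable_sqnorm.
by move=> w; rewrite ger0_norm ?gauss_ge0 // gauss_le1 // sqnorm_ge0.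
Qed.

(** The Taylor bound is integrated with [u = X] and [v = X' - X]. The weights of its linear and
    quadratic terms are bounded and [G]-measurable, so the linear term vanishes and [|v|^2] becomes
    [c]; the time shift inequality concludes. *)
Lemma Rintegral_gauss_step (G : set (set T)) (X X' : T -> 'rV[R]_d) (s c : R) :
  sigma_algebra setT G -> G `<=` measurable ->
  (forall i, measurable_wrt G (fun w => X w ord0 i)) ->
  (forall i, measurable_fun setT (fun w => X' w ord0 i)) ->
  (forall i, is_condexp P G (fun w => X' w ord0 i) (fun w => X w ord0 i)) ->
  is_condexp P G (fun w => enorm (X' w - X w) ^+ 2) (fun=> c) ->
  {ae P, forall w, enorm (X' w - X w) <= 1} ->
  1 <= s -> 0 <= c <= 1 ->
  \int[P]_w gauss s (sqnorm (X' w)) <=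
    Num.sqrt (s / (s + c)) * \int[P]_w gauss (s + c) (sqnorm (X w))
    + 11 * expR 5 * Num.sqrt s ^- 3 * \int[P]_w gauss (2 * s) (sqnorm (X w)).
Proof.
move=> sG GT mX mX' XX' var step s1 c01.
have s0 : 0 < s by lra.
have c0 : 0 <= c by case/andP: c01.
have mXT i := measurable_wrt_measurable_fun GT (mX i).
pose g w := gauss s (sqnorm (X w)).
(* [Z i] is the weight of the i-th coordinate of the increment, up to sign, and [H] that of its
   squared norm. *)
pose Z i w := g w * X w ord0 i / s.
pose H w := g w * ((sqnorm (X w) / s - 1) / (2 * s)).
have g01 w : 0 <= g w <= 1 by rewrite gauss_ge0 gauss_le1 // sqnorm_ge0.
have mXG i := (measurable_wrt_g_sigma_algebraP _ sG).1 (mX i).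
have mqG : measurable_fun setT (fun w : g_sigma_algebraType G => sqnorm (X w)).
  exact: measurable_sqnorm.
have mgG : measurable_fun setT (g : g_sigma_algebraType G -> R).
  exact: measurable_gauss.
have mZ i : measurable_wrt G (Z i).
  apply/measurable_wrt_g_sigma_algebraP => //.
  by apply: measurable_funM => //; exact: measurable_funM.
have mH : measurable_wrt G H.
  apply/measurable_wrt_g_sigma_algebraP => //.
  apply: measurable_funM => //; apply: measurable_funM => //.
  by apply: measurable_funB => //; exact: measurable_funM.
have Zb i w : `|Z i w| <= 1 + 2 * s.
  have /andP[g0 g1] := g01 w.
  have h1 := mul_gauss_le (sqnorm (X w)) s0.
  have h2 := sqr_coord_le_sqnorm (X w) i.
  have h3 : `|X w ord0 i| <= 1 + sqnorm (X w).
    apply: le_trans (_ : 1 + X w ord0 i ^+ 2 <= _); last by rewrite lerD2l.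
    rewrite -[_ ^+ 2]real_normK ?num_real //.
    by have := sqr_ge0 (`|X w ord0 i| - 1); nra.
  have sV : s^-1 <= 1 by rewrite invf_le1.
  rewrite /Z normrM normfV (gtr0_norm s0) normrM (ger0_norm g0).
  have h4 : g w * `|X w ord0 i| <= 1 + 2 * s.
    apply: le_trans (_ : g w * (1 + sqnorm (X w)) <= _); first exact: ler_wpM2l.
    rewrite mulrDr mulr1 lerD // mulrC; exact: h1.
  by rewrite ler_pdivrMr //; apply: (le_trans h4); nra.
have Hb w : `|H w| <= 3.
  have /andP[g0 g1] := g01 w.
  have h1 := mul_gauss_le (sqnorm (X w)) s0.
  have q0 := sqnorm_ge0 (X w).
  have -> : H w = (sqnorm (X w) * g w / s - g w) / (2 * s).
    by rewrite /H; ring.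
  have h2 : 0 <= sqnorm (X w) * g w / s <= 2.
    rewrite divr_ge0 ?mulr_ge0 ?(ltW s0) //=.
    by rewrite ler_pdivrMr //; exact: h1.
  rewrite normrM normfV (gtr0_norm (_ : 0 < 2 * s)) ?mulr_gt0 //.
  rewrite ler_pdivrMr ?mulr_gt0 //.
  case/andP: h2 => h2 h3; rewrite (le_trans (ler_normB _ _)) // !ger0_norm //.
  nra.
pose B w := enorm (X' w - X w) ^+ 2.
pose E w := gauss (2 * s) (sqnorm (X w)).
have [intB _ _ _] := var.
have intX' i : P.-integrable setT (EFin \o (fun w => X' w ord0 i)) by case: (XX' i).
have intX i : P.-integrable setT (EFin \o (fun w => X w ord0 i)) by case: (XX' i).
have mZT i := measurable_wrt_measurable_fun GT (mZ i).
have mHT := measurable_wrt_measurable_fun GT mH.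
have intZX' i := integrable_bounded_mul (mZT i) (Zb i) (intX' i).
have intZX i := integrable_bounded_mul (mZT i) (Zb i) (intX i).
have intHB := integrable_bounded_mul mHT Hb intB.
have intH := integrable_bounded P mHT Hb.
have intg : P.-integrable setT (EFin \o g) by exact: integrable_gauss.
have intE : P.-integrable setT (EFin \o E) by apply: integrable_gauss => //; lra.
have intZd i : P.-integrable setT
    (EFin \o (fun w => Z i w * X' w ord0 i - Z i w * X w ord0 i)).
  exact: (integrableB measurableT (intZX' i) (intZX i)).
pose L w := \sum_(i < d) (Z i w * X' w ord0 i - Z i w * X w ord0 i).
have intL : P.-integrable setT (EFin \o L) by exact: integrable_sumR.
have L0 : \int[P]_w L w = 0.
  rewrite Rintegral_sum // big1 // => i _; rewrite RintegralB //.
  by rewrite (condexp_bounded_mul sG GT (XX' i) (mZ i) (Zb i)) subrr.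
have HB : \int[P]_w (H w * B w) = c * \int[P]_w H w.
  rewrite (condexp_bounded_mul sG GT var mH Hb).
  by rewrite RintegralZr // mulrC.
set K := 7 * expR 5 * Num.sqrt s ^- 3.
have intKE : P.-integrable setT (EFin \o (fun w => K * E w)).
  exact: (@integrableZl _ _ _ P setT measurableT K _ intE).
have intgL : P.-integrable setT (EFin \o (fun w => g w - L w)).
  exact: (integrableB measurableT intg intL).
have intgLH : P.-integrable setT (EFin \o (fun w => g w - L w + H w * B w)).
  exact: (integrableD measurableT intgL intHB).
have le1 : \int[P]_w gauss s (sqnorm (X' w)) <=
    \int[P]_w (g w - L w + H w * B w + K * E w).
  apply: ae_le_Rintegral.
  - exact: integrable_gauss.
  - exact: (integrableD measurableT intgLH intKE).
  apply: filterS step => w hw.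
  (* Almost surely the increment has norm at most 1, as the Taylor bound demands. *)
  have := @gauss_taylor_le R d s (X w) (X' w - X w) s1.
  rewrite -enorm_le1 hw subrKC => /(_ isT) h; apply: (le_trans h).
  rewrite lerD2r /B enorm_sqr /H -/(g w).
  have -> : L w = g w * (dotp (X w) (X' w - X w) / s).
    rewrite /L /dotp mulr_suml mulr_sumr; apply: eq_bigr => i _.
    by rewrite /Z !mxE; ring.
  by rewrite le_eqVlt; apply/orP; left; apply/eqP; ring.
apply: (le_trans le1).
rewrite RintegralD // RintegralD // RintegralB // L0 subr0 HB RintegralZl //.
have intcH : P.-integrable setT (EFin \o (fun w => c * H w)).
  exact: (@integrableZl _ _ _ P setT measurableT c _ intH).
rewrite -RintegralZl // -RintegralD //.
pose Fc w := gauss (s + c) (sqnorm (X w)).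
have intF : P.-integrable setT (EFin \o Fc) by apply: integrable_gauss => //; lra.
set a := Num.sqrt (s / (s + c)); set b := 4 * Num.sqrt s ^- 3.
have intaF : P.-integrable setT (EFin \o (fun w => a * Fc w)).
  exact: (@integrableZl _ _ _ P setT measurableT a _ intF).
have intbE : P.-integrable setT (EFin \o (fun w => b * E w)).
  exact: (@integrableZl _ _ _ P setT measurableT b _ intE).
have le2 : \int[P]_w (g w + c * H w) <= \int[P]_w (a * Fc w + b * E w).
  apply: le_Rintegral => //.
  - exact: (integrableD measurableT intg intcH).
  - exact: (integrableD measurableT intaF intbE).
  move=> w _; have := gauss_time_shift_le s1 c01 (sqnorm_ge0 (X w)).
  apply: le_trans; rewrite /H /g le_eqVlt; apply/orP; left; apply/eqP; ring.
rewrite [X in _ <= X]RintegralD // !RintegralZl // in le2.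
have E0 : 0 <= \int[P]_w E w by apply: Rintegral_ge0 => w _; exact: gauss_ge0.
have S3 : 0 <= Num.sqrt s ^- 3 by rewrite invr_ge0 exprn_ge0 // sqrtr_ge0.
(* The 11 adds the 7 of the Taylor remainder and the 4 of the time shift, using [exp 5 >= 1]. *)
have bK : b + K <= 11 * expR 5 * Num.sqrt s ^- 3.
  rewrite /b /K; have : 1 <= expR 5 :> R by rewrite -expR0 ler_expR.
  by move=> h; rewrite -mulrDl ler_wpM2r //; lra.
have := ler_wpM2r E0 bK; rewrite mulrDl.
rewrite -/(Fc _) => h.
change (\int[P]_w (g w + c * H w) + K * \int[P]_w E w <=
   a * \int[P]_w Fc w + 11 * expR 5 * Num.sqrt s ^- 3 * \int[P]_w E w).
lra.
Qed.

End OneStep.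


(** * Induction on time *)

(* The gain [D / sqrt s - D / sqrt (s + c) >= D c / (6 s^(3/2))] pays for the
   error term as soon as [D = 18 K / c]. *)
Lemma gauss_bound_step (R : realType) (K D c s t : R) :
  0 <= K -> 0 < c <= 1 -> D = 18 * K / c -> 1 <= s -> D <= Num.sqrt s -> 0 <= t ->
  Num.sqrt (s / (s + c)) *
    ((1 + D / Num.sqrt (s + c)) * Num.sqrt ((s + c) / (s + c + t)))
  + K * Num.sqrt s ^- 3 *
    ((1 + D / Num.sqrt (2 * s)) * Num.sqrt (2 * s / (2 * s + t)))
  <= (1 + D / Num.sqrt s) * Num.sqrt (s / (s + (c + t))).
Proof.
move=> K0 /andP[c0 c1] DE s1 DS t0.
have s0 : 0 < s by lra.
have D0 : 0 <= D by rewrite DE divr_ge0 ?mulr_ge0 // ltW.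
set S := Num.sqrt s; set S' := Num.sqrt (s + c); set W := Num.sqrt (s / (s + (c + t))).
have S0 : 0 < S by rewrite sqrtr_gt0.
have S'0 : 0 < S' by rewrite sqrtr_gt0; lra.
have SE : S ^+ 2 = s by rewrite sqr_sqrtr // ltW.
have S'E : S' ^+ 2 = s + c by rewrite sqr_sqrtr //; lra.
have W0 : 0 <= W by exact: sqrtr_ge0.
have S'2 : S' <= 2 * S.
  by rewrite -(@ler_pXn2r _ 2%N) ?nnegrE ?mulr_ge0 ?ltW // exprMn SE S'E; lra.
have S3 : 0 <= S ^- 3 by rewrite invr_ge0 exprn_ge0 // ltW.
have eW : Num.sqrt (s / (s + c)) * Num.sqrt ((s + c) / (s + c + t)) = W.
  rewrite -sqrtrM ?divr_ge0 ?addr_ge0 ?(ltW s0) ?(ltW c0) //.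
  congr Num.sqrt; rewrite addrA; field.
  by rewrite !gt_eqF //; lra.
(* The quotient of the two radicands is at most 2 because [c <= s], and [2 <= (3/2)^2]. *)
have leW : Num.sqrt (2 * s / (2 * s + t)) <= 3 / 2 * W.
  have -> : 3 / 2 * W = Num.sqrt ((3 / 2) ^+ 2 * (s / (s + (c + t)))).
    by rewrite sqrtrM ?sqr_ge0 // sqrtr_sqr ger0_norm.
  rewrite ler_wsqrtr // ler_pdivrMr; last by lra.
  rewrite mulrA mulrAC ler_pdivlMr; last by lra.
  have -> : (3 / 2) ^+ 2 * s * (2 * s + t) = s * ((9 / 4) * (2 * s + t)) by field.
  have -> : 2 * s * (s + (c + t)) = s * (2 * (s + (c + t))) by ring.
  by apply: ler_wpM2l; [exact: ltW | lra].
set B := 1 + D / Num.sqrt (2 * s).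
have B2 : 1 <= B <= 2.
  have S1 : Num.sqrt s <= Num.sqrt (2 * s) by rewrite ler_wsqrtr //; lra.
  have S2 : 0 < Num.sqrt (2 * s) by rewrite sqrtr_gt0; lra.
  rewrite /B lerDl divr_ge0 ?(ltW S2) //= -lerBrDl ler_pdivrMr //.
  lra.
(* The 3 is the product of the bounds 2 on [B] and 3/2 in [leW]. As [D c = 18 K] and
   [S S' (S + S') <= 6 S^3], the gain is at least [18 K / (6 S^3)]. *)
have gain : 3 * K * S ^- 3 <= D / S - D / S'.
  have -> : D / S - D / S' = 18 * K / (S * S' * (S + S')).
    have -> : D / S - D / S' = D * (S' ^+ 2 - S ^+ 2) / (S * S' * (S + S')).
      by field; rewrite !gt_eqF // addr_gt0.
    rewrite S'E SE DE; field.
    by rewrite !gt_eqF // addr_gt0.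
  have -> : 3 * K * S ^- 3 = 18 * K / (6 * S ^+ 3) by field; rewrite gt_eqF.
  rewrite ler_wpM2l ?mulr_ge0 // lef_pV2 ?posrE ?mulr_gt0 ?addr_gt0 ?exprn_gt0 //.
  have -> : 6 * S ^+ 3 = S * (2 * S) * (3 * S) by ring.
  rewrite ler_pM ?mulr_ge0 ?addr_ge0 ?(ltW S0) ?(ltW S'0) //; last by lra.
  by rewrite ler_wpM2l // ltW.
have err : K * S ^- 3 * (B * Num.sqrt (2 * s / (2 * s + t))) <=
    3 * K * S ^- 3 * W.
  have h : B * Num.sqrt (2 * s / (2 * s + t)) <= 2 * (3 / 2 * W).
    case/andP: B2 => b1 b2; apply: ler_pM => //.
    lra.
  have KS : 0 <= K * S ^- 3 by rewrite mulr_ge0.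
  have := ler_wpM2l KS h; lra.
rewrite mulrCA eW.
apply: (le_trans (lerD (lexx _) err)).
by have := ler_wpM2r W0 gain; lra.
Qed.

Section Martingale.
Context {disp : measure_display} {T : measurableType disp} {R : realType}.
Context (P : probability T R).

Lemma ae_of_probability1 (A : set T) : measurable A -> P A = 1%E ->
  {ae P, forall w, A w}.
Proof.
move=> mA PA; exists (~` A); split => //; first exact: measurableC.
by have := probability_setC P mA; rewrite PA subee.
Qed.

Lemma measurable_enorm_le1 (d : nat) (X : T -> 'rV[R]_d) :
  (forall i, measurable_fun setT (fun w => X w ord0 i)) ->
  measurable [set w | enorm (X w) <= 1].
Proof.
move=> mX; have := measurable_sqnorm mX measurableT (measurable_itv `]-oo, 1]).
rewrite setTI; congr measurable; apply/seteqP.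
by split => w /=; rewrite in_itv /= enorm_le1.
Qed.

(** On the unit ball [|x|^2 / (2 s) <= 1/2], so [e] times the Gaussian dominates the indicator of
    the ball. *)
Lemma probability_enorm_le1 (d : nat) (X : T -> 'rV[R]_d) (s : R) : 1 <= s ->
  (forall i, measurable_fun setT (fun w => X w ord0 i)) ->
  (P [set w | (enorm (X w) <= 1)%R] <=
    (expR 1 * \int[P]_w gauss s (sqnorm (X w)))%:E)%E.
Proof.
move=> s1 mX; have mA := measurable_enorm_le1 mX; set A := [set w | _] in mA *.
have s0 : 0 < s by lra.
have intG := integrable_gauss P s0 mX.
have -> : P A = (\int[P]_w \1_A w)%:E.
  rewrite /Rintegral integral_indic // setIT fineK //.
  by rewrite fin_num_measure.
rewrite lee_fin -RintegralZl //; apply: le_Rintegral => //.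
- by apply: integrable_indic.
- exact: (@integrableZl _ _ _ P setT measurableT (expR 1) _ intG).
move=> w _; rewrite indicE; case: (boolP (w \in A)) => [/set_mem Aw|_]; last first.
  by rewrite mulr_ge0 ?expR_ge0 ?gauss_ge0.
rewrite /gauss -expRD; apply: le_trans (expR_ge1Dx _).
rewrite lerDl subr_ge0 ler_pdivrMr ?mulr_gt0 //.
by move: Aw; rewrite /A /= enorm_le1; lra.
Qed.

(** [s] stays universally quantified in the induction: the step at [s] calls the hypothesis at
    [s + c] and at [2 s], and both inherit the lower bounds on [s]. The base case is
    [gauss <= 1]. *)
Lemma martingale_gauss_bound (F : nat -> set (set T)) (d : nat)
    (M : nat -> T -> 'rV[R]_d) (c : R) :
  0 < c <= 1 -> filtration F -> martingale P F M ->
  (forall n, P [set w | enorm (M n.+1 w - M n w) <= 1] = 1%E) ->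
  (forall n, is_condexp P (F n) (fun w => enorm (M n.+1 w - M n w) ^+ 2)
               (fun=> c)) ->
  let D := 18 * (11 * expR 5) / c in
  forall n s, 1 <= s -> D <= Num.sqrt s ->
  \int[P]_w gauss s (sqnorm (M n w)) <=
    (1 + D / Num.sqrt s) * Num.sqrt (s / (s + c * n%:R)).
Proof.
move=> c01 [sF FT _] [mM _ MM] step var D.
have /andP[c0 c1] := c01.
have K0 : 0 <= 11 * expR 5 :> R by rewrite mulr_ge0 ?expR_ge0.
have D0 : 0 <= D by rewrite divr_ge0 ?mulr_ge0 ?expR_ge0 // ltW.
have mMT n i := measurable_wrt_measurable_fun (FT n) (mM n i).
elim=> [|n IH] s s1 DS; have s0 : 0 < s by lra.
  rewrite mulr0 addr0 divff ?gt_eqF // sqrtr1 mulr1.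
  apply: (@le_trans _ _ 1); last by rewrite lerDl divr_ge0 // sqrtr_ge0.
  apply: (@le_trans _ _ (\int[P]_w (fun=> 1) w)).
    apply: le_Rintegral => //.
    - exact: integrable_gauss.
    - by apply: (@integrable_bounded _ _ _ _ _ 1) => // w; rewrite normr1.
    - by move=> w _; rewrite gauss_le1 ?sqnorm_ge0.
  rewrite Rintegral_cst // mul1r le_eqVlt; apply/orP; left; apply/eqP.
  exact: (congr1 fine (@probability_setT _ _ _ P)).
have ae1 : {ae P, forall w, enorm (M n.+1 w - M n w) <= 1}.
  apply: (@ae_of_probability1 [set w | enorm (M n.+1 w - M n w) <= 1]) => //.
  apply: (@measurable_enorm_le1 _ (fun w => M n.+1 w - M n w)) => i.
  under eq_fun do rewrite !mxE.
  exact: measurable_funB.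
have c01' : 0 <= c <= 1 by rewrite ltW.
apply: le_trans (Rintegral_gauss_step (sF n) (FT n) (mM n) (mMT n.+1) (MM n)
  (var n) ae1 s1 c01') _.
have t0 : 0 <= c * n%:R by rewrite mulr_ge0 // ltW.
have := gauss_bound_step K0 c01 (erefl D) s1 DS t0.
rewrite -[n.+1%:R]natr1 (mulrDr c) mulr1 (addrC (c * _)) => h; apply: (le_trans _ h).
apply: lerD; apply: ler_wpM2l.
- exact: sqrtr_ge0.
- apply: IH; first by lra.
  by apply: (le_trans DS); rewrite ler_wsqrtr //; lra.
- by rewrite mulr_ge0 // invr_ge0 exprn_ge0 // sqrtr_ge0.
- apply: IH; first by lra.
  by apply: (le_trans DS); rewrite ler_wsqrtr //; lra.
Qed.

End Martingale.

(** * Choice of the variance and of the constant *)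

Theorem corollary1p2 (R : realType) (lambda : R)
    (lambda_gt0 : 0 < lambda) (lambda_le1 : lambda <= 1) :
  exists C : R, 1 <= C /\
    forall (disp : measure_display) (T : measurableType disp)
      (P : probability T R) (F : nat -> set (set T)) (d : nat)
      (M : nat -> T -> 'rV[R]_d),
      (1 <= d)%N ->
      filtration F ->
      martingale P F M ->
      {ae P, forall w, M 0%N w = 0} ->
      (forall n : nat, P [set w | enorm (M n.+1 w - M n w) <= 1] = 1%E) ->
      (forall n : nat,
        is_condexp P (F n) (fun w => enorm (M n.+1 w - M n w) ^+ 2)
          (fun=> lambda ^+ 2)) ->
      forall n : nat, (1 <= n)%N ->
        (P [set w | (enorm (M n w) <= 1)%R] <= (C * n%:R `^ (- (1 / 2)))%:E)%E.
Proof.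
pose c := lambda ^+ 2.
have c01 : 0 < c <= 1 by rewrite exprn_gt0 //= expr_le1 // ltW.
have /andP[c0 c1] := c01.
pose D : R := 18 * (11 * expR 5) / c.
have D0 : 0 <= D by rewrite divr_ge0 ?mulr_ge0 ?expR_ge0 // ltW.
(* This gives [1 <= s] and [D <= sqrt s] at once, and depends on [lambda] only. *)
pose s := 1 + D ^+ 2.
have s1 : 1 <= s by rewrite lerDl sqr_ge0.
have s0 : 0 < s by lra.
have S0 : 0 < Num.sqrt s by rewrite sqrtr_gt0.
have DS : D <= Num.sqrt s.
  by rewrite -[leLHS](ger0_norm D0) -sqrtr_sqr ler_wsqrtr // lerDr.
(* The 2 bounds [1 + D / sqrt s], the [e] comes from the ball estimate, and [sqrt s / lambda] from
   dropping [s] in the denominator [s + c n]. *)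
pose C0 := 2 * expR 1 * Num.sqrt s / lambda.
have C00 : 0 <= C0 by rewrite divr_ge0 ?mulr_ge0 ?expR_ge0 ?sqrtr_ge0 // ltW.
exists (1 + C0); split; first by rewrite lerDl.
move=> disp T P F d M _ fF mM _ step var n n1.
have [sF FT _] := fF; have [mMF _ _] := mM.
have mMT i := measurable_wrt_measurable_fun (FT n) (mMF n i).
apply: le_trans (probability_enorm_le1 P s1 mMT) _; rewrite lee_fin.
have n0 : 0 < n%:R :> R by rewrite ltr0n.
have Phi := martingale_gauss_bound c01 fF mM step var n s1 DS.
have -> : n%:R `^ (- (1 / 2)) = (Num.sqrt n%:R)^-1 :> R.
  by rewrite powRN div1r powR12_sqrt // ltW.
have sn0 : 0 < Num.sqrt n%:R :> R by rewrite sqrtr_gt0.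
have leS : Num.sqrt (s / (s + c * n%:R)) <= Num.sqrt s / (lambda * Num.sqrt n%:R).
  have -> : lambda * Num.sqrt n%:R = Num.sqrt (c * n%:R).
    by rewrite sqrtrM ?ltW // sqrtr_sqr gtr0_norm.
  have cn : 0 < c * n%:R by rewrite mulr_gt0.
  rewrite -sqrtrV; last exact: ltW.
  rewrite -sqrtrM; last exact: ltW.
  apply: ler_wsqrtr; apply: ler_wpM2l; first exact: ltW.
  by rewrite lef_pV2 ?posrE //; lra.
have le2 : 1 + D / Num.sqrt s <= 2.
  by rewrite -lerBrDl ler_pdivrMr //; lra.
have b0 : 0 <= 1 + D / Num.sqrt s by rewrite addr_ge0 // divr_ge0 // ltW.
have Phi2 : \int[P]_w gauss s (sqnorm (M n w)) <=
    2 * (Num.sqrt s / (lambda * Num.sqrt n%:R)).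
  by apply: (le_trans Phi); apply: ler_pM => //; exact: sqrtr_ge0.
apply: le_trans (ler_wpM2l (expR_ge0 1) Phi2) _.
have -> : expR 1 * (2 * (Num.sqrt s / (lambda * Num.sqrt n%:R))) =
    C0 / Num.sqrt n%:R.
  by rewrite /C0; field; rewrite !gt_eqF.
by rewrite ler_wpM2r ?invr_ge0 ?(ltW sn0) // lerDr.
Qed.
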